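(* Let $f:\mathbb{R}^D\to\mathbb{R}$ be continuously differentiable with effective dimensionality $d_e$, let $\rho$ be a probability distribution on $\mathbb{R}^D$, and let $$\hat{\boldsymbol{C}}=\frac1M\sum_{j=1}^M\nabla f(\boldsymbol{x}_S^j)\nabla f(\boldsymbol{x}_S^j)^T,$$ where $\boldsymbol{x}_S^1,\dots,\boldsymbol{x}_S^M\in\mathbb{R}^D$ ($M\ge1$) are samples drawn independently at random according to $\rho$. Let $d:=\operatorname{rank}(\hat{\boldsymbol{C}})$. Then $d\le d_e$.
   Context: A function $f:\mathbb{R}^D\to\mathbb{R}$ has effective dimensionality $d_e\le D$ if (i) there exists a linear subspace $\mathcal{T}\subset\mathbb{R}^D$ of dimension $d_e$ such that $f(\boldsymbol{x}_\top+\boldsymbol{x}_\perp)=f(\boldsymbol{x}_\top)$ for all $\boldsymbol{x}_\top\in\mathcal{T}$ and all $\boldsymbol{x}_\perp\in\mathcal{T}^\perp$, and (ii) $d_e$ is the smallest integer with this property. The conclusion holds for every realization of the samples. *)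

(* Defs.v *)
From mathcomp Require Import all_boot all_order all_algebra.
From mathcomp Require Import all_classical all_reals all_analysis.

Set Implicit Arguments.
Unset Strict Implicit.
Unset Printing Implicit Defensive.

Import Order.TTheory GRing.Theory Num.Theory.
Import numFieldNormedType.Exports.

Local Open Scope classical_set_scope.
Local Open Scope ring_scope.

Definition gradient (R : realType) (D : nat) (f : 'cV[R]_D -> R)
    (x : 'cV[R]_D) : 'cV[R]_D :=
  \col_i 'D_(delta_mx i 0) f x.

Definition continuously_differentiable (R : realType) (D : nat)
    (f : 'cV[R]_D -> R) : Prop :=
  (forall x, differentiable f x) /\ continuous (gradient f).

Definition dotv (R : realType) (D : nat) (x y : 'cV[R]_D) : R :=
  \sum_(i < D) x i 0 * y i 0.

Definition orthogonal_complement (R : realType) (D : nat)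
    (T : {vspace 'cV[R]_D}) : set 'cV[R]_D :=
  [set y | forall x, x \in T -> dotv x y = 0].

Definition varies_only_along (R : realType) (D : nat) (f : 'cV[R]_D -> R)
    (T : {vspace 'cV[R]_D}) : Prop :=
  forall x y, x \in T -> orthogonal_complement T y -> f (x + y) = f x.

(* The bound d_e <= D follows from dim T <= D. *)
Definition effective_dimensionality (R : realType) (D : nat)
    (f : 'cV[R]_D -> R) (d_e : nat) : Prop :=
  (exists T : {vspace 'cV[R]_D}, \dim T = d_e /\ varies_only_along f T) /\
  (forall (d : nat) (T : {vspace 'cV[R]_D}),
     \dim T = d -> varies_only_along f T -> (d_e <= d)%N).

(* R^D with its Borel sigma-algebra *)
Definition borelV (R : realType) (D : nat) :=
  g_sigma_algebraType (@open 'cV[R]_D).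

Definition mutually_independent (R : realType) (dO dT : measure_display)
    (Omega : measurableType dO) (T : measurableType dT)
    (P : probability Omega R) (M : nat) (X : 'I_M -> {RV P >-> T}) : Prop :=
  forall (J : {set 'I_M}) (A : 'I_M -> set T),
    (forall j, measurable (A j)) ->
    P (\bigcap_(j in [set` J]) (X j @^-1` A j)) =
    (\prod_(j in J) P (X j @^-1` A j))%E.

(* Restricted to measurable sets: the values of a measure elsewhere are junk. *)
Definition has_law (R : realType) (dO dT : measure_display)
    (Omega : measurableType dO) (T : measurableType dT)
    (P : probability Omega R) (X : {RV P >-> T}) (rho : probability T R) : Prop :=
  forall A : set T, measurable A -> distribution P X A = rho A.

Definition Chat (R : realType) (D M : nat) (f : 'cV[R]_D -> R)
    (x : 'I_M -> 'cV[R]_D) : 'M[R]_D :=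
  M%:R^-1 *: \sum_(j < M) gradient f (x j) *m (gradient f (x j))^T.

(* Main.v *)
(** Let P be the orthogonal projection onto a subspace T realizing d_e. Then
    f = f \o P, so all derivatives of f along vectors (1 - P) v vanish. Hence
    (grad f)^T = (grad f)^T P everywhere, Chat = Chat P, and the rank of Chat
    is at most rank P <= dim T. *)

Require Import Defs.
From mathcomp Require Import all_boot all_order all_algebra.
From mathcomp Require Import all_classical all_reals all_analysis.
Import numFieldNormedType.Exports.
Local Open Scope ring_scope.

Set Implicit Arguments.
Unset Strict Implicit.

Import GRing.Theory Num.Theory.

Lemma dotvE (R : realType) (D : nat) (x y : 'cV[R]_D) :
  dotv x y = (x^T *m y) 0 0.
Proof. by rewrite mxE; apply: eq_bigr => i _; rewrite mxE. Qed.

Lemma mulmx_tr_eq0 (R : realType) (n : nat) (u : 'rV[R]_n) :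
  u *m u^T = 0 -> u = 0.
Proof.
move=> /matrixP /(_ 0 0); rewrite !mxE => /eqP.
rewrite psumr_eq0 => [/allP u0|i _]; last by rewrite mxE -expr2 sqr_ge0.
apply/rowP => i; rewrite [RHS]mxE.
by have := u0 i (mem_index_enum i); rewrite mxE /= mulf_eq0 orbb => /eqP.
Qed.

(** If [u *m A *m A^T = 0], then [u *m A] has zero sum of squares, hence vanishes, and independence
    of the rows of [A] gives [u = 0]. *)
Lemma gram_unitmx (R : realType) (m n : nat) (A : 'M[R]_(m, n)) :
  row_free A -> A *m A^T \in unitmx.
Proof.
move=> Afree; rewrite -row_free_unit; apply/row_freeP.
have /eqP ker0 : kermx (A *m A^T) == 0.
  apply/rowV0P => u /sub_kermxP uAA0.
  apply: (row_free_inj Afree); rewrite mul0mx; apply: mulmx_tr_eq0.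
  by rewrite trmx_mul mulmxA -(mulmxA u) uAA0 mul0mx.
by apply/row_freeP; rewrite -kermx_eq0 ker0.
Qed.

(** With the transposed basis vectors of [T] as rows of [A], the classical projector
    [A^T (A A^T)^-1 A] works. Its right factor [A] has only [\dim T] rows, which bounds the rank. *)
Lemma orthogonal_projection (R : realType) (D : nat)
    (T : {vspace 'cV[R]_D}) :
  exists P : 'M[R]_D, [/\ (\rank P <= \dim T)%N, P *m P = P,
    forall x, P *m x \in T &
    forall x, orthogonal_complement T (x - P *m x)].
Proof.
pose b := vbasis T.
pose A : 'M[R]_(\dim T, D) := \matrix_(i, j) b`_i j 0.
have combA (u : 'rV_(\dim T)) : (u *m A)^T = \sum_i u 0 i *: b`_i.
  apply/colP => j; rewrite !mxE summxE.
  by apply: eq_bigr => i _; rewrite !mxE.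
have inT (u : 'rV_(\dim T)) : (u *m A)^T \in T.
  rewrite combA; apply: memv_suml => i _; apply: memvZ.
  by apply: vbasis_mem; apply: mem_nth; rewrite size_tuple.
have Tcomb x : x \in T -> exists u : 'rV_(\dim T), x = (u *m A)^T.
  move=> /coord_vbasis xE; exists (\row_i coord b i x).
  by rewrite combA {1}xE; apply: eq_bigr => i _; rewrite mxE.
have Afree : row_free A.
  rewrite -kermx_eq0; apply/rowV0P => u /sub_kermxP uA0.
  apply/rowP => i; rewrite mxE.
  have /freeP := basis_free (vbasisP T).
  by apply; rewrite -combA uA0 trmx0.
have Gunit := gram_unitmx Afree.
pose G := A *m A^T.
exists (A^T *m invmx G *m A); split.
- by apply: leq_trans (mxrankM_maxr _ _) _; exact: rank_leq_row.
- by rewrite !mulmxA -(mulmxA _ A) -/G mulmxKV.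
- move=> x; have -> : A^T *m invmx G *m A *m x
      = ((invmx G *m A *m x)^T *m A)^T by rewrite trmx_mul trmxK !mulmxA.
  exact: inT.
(* The residual is killed by [A], since [A P x = G G^-1 A x = A x]. *)
- move=> x y /Tcomb[u ->]; rewrite dotvE trmxK -mulmxA mulmxBr !mulmxA.
  by rewrite -/G mulmxV // mul1mx subrr mulmx0 mxE.
Qed.

(** The differential is linear, so [v] may be expanded in the standard basis. *)
Lemma derive_gradient (R : realType) (D : nat) (f : 'cV[R]_D -> R)
    (x v : 'cV[R]_D) :
  differentiable f x -> 'D_v f x = ((gradient f x)^T *m v) 0 0.
Proof.
move=> df; rewrite deriveE // [in LHS](matrix_sum_delta v) linear_sum mxE.
apply: eq_bigr => i _.
by rewrite big_ord1 linearZ !mxE deriveE // mulrC.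
Qed.

Lemma derive_invariant (R : realType) (V W : normedModType R) (f : V -> W)
    (x v : V) :
  (forall h : R, f (h *: v + x) = f x) -> 'D_v f x = 0.
Proof.
move=> fv; rewrite /derive.
under eq_fun do rewrite /= fv subrr scaler0.
exact: lim_cst.
Qed.

Lemma gradient_projection (R : realType) (D : nat) (f : 'cV[R]_D -> R)
    (P : 'M[R]_D) (x : 'cV[R]_D) :
  differentiable f x -> P *m P = P -> (forall y, f (P *m y) = f y) ->
  (gradient f x)^T *m P = (gradient f x)^T.
Proof.
move=> df PP fP; apply/esym/eqP; rewrite -subr_eq0 -{1}[_^T]mulmx1 -mulmxBr.
apply/eqP/rowP => i.
(* Entry [i] of the row to be killed is the derivative of [f] along column [i] of [1 - P]. *)
have := derive_gradient ((1%:M - P) *m delta_mx i 0) df.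
rewrite mulmxA -(colE _ (_ *m (1%:M - P))) [RHS]mxE => gE.
rewrite [RHS]mxE -gE.
(* Moving along that column does not change the image under [P], because [P (1 - P) = 0]. *)
apply: derive_invariant => h; rewrite -fP -[RHS]fP; congr f.
rewrite mulmxDr -scalemxAr mulmxA mulmxBr mulmx1 PP subrr.
by rewrite mul0mx scaler0 add0r.
Qed.

Theorem lemma3p1 (R : realType) (D d_e : nat) (f : 'cV[R]_D -> R)
    (rho : probability (borelV R D) R)
    (dO : measure_display) (Omega : measurableType dO)
    (P : probability Omega R)
    (M : nat) (X : 'I_M -> {RV P >-> borelV R D}) :
  continuously_differentiable f ->
  effective_dimensionality f d_e ->
  (0 < M)%N ->
  (forall j : 'I_M, has_law (X j) rho) ->
  mutually_independent X ->
  forall w : Omega, (\rank (Chat f (fun j => X j w)) <= d_e)%N.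
Proof.
move=> [df _] [[T [<- fT]] _] _ _ _ w.
have [Q [rkQ QQ QT Qperp]] := orthogonal_projection T.
have fQ y : f (Q *m y) = f y.
  (* Split [y] as [Q y + (y - Q y)], with the first summand in [T] and the second orthogonal to
     it. *)
  by rewrite -[in RHS](subrKC (Q *m y) y) fT.
suff -> : Chat f (fun j => X j w) = Chat f (fun j => X j w) *m Q.
  exact: leq_trans (mxrankM_maxr _ _) rkQ.
(* Each rank-one summand absorbs [Q] through its right factor, the transposed gradient at the
   sample. *)
rewrite /Chat -scalemxAl mulmx_suml; congr (_ *: _); apply: eq_bigr => j _.
by rewrite -mulmxA gradient_projection.
Qed.
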